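(* Let $S$ be a finite nonempty set and $1\le k<n$ integers. Let $\phi^*$ be the ring homomorphism of the general nonhomogeneous $k$-th order multistate Markov model on $S$ for paths of length $n$. Then the ideal $\ker(\phi^* )\subseteq\mathbb{R}[p_{i_1\ldots i_n}\mid (i_1,\dots,i_n)\in S^n]$ is generated by the polynomials $$p_{IJK}\,p_{I'JK'}-p_{IJK'}\,p_{I'JK},$$ where $r$ ranges over integers with $0\le r\le n-k$, and $I=(i_1,\ldots,i_r)$, $I'=(i'_1,\ldots,i'_r)$ range over $S^r$, $J=(j_{r+1},\ldots,j_{r+k})$ ranges over $S^k$, and $K=(s_{r+k+1},\ldots,s_n)$, $K'=(s'_{r+k+1},\ldots,s'_n)$ range over $S^{n-k-r}$. Here $p_{IJK}$ denotes the variable indexed by the concatenated path $(i_1,\dots,i_r,j_{r+1},\dots,j_{r+k},s_{r+k+1},\dots,s_n)$, and similarly for the other terms.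
   Context: The homomorphism $$\phi^*:\mathbb{R}[p_{i_1\ldots i_n}\mid (i_1,\dots,i_n)\in S^n]\to\mathbb{R}\bigl[\pi_{i_1\ldots i_k},\,a^{(\ell)}_{i_{\ell-k}\cdots i_\ell}\mid \ell=k+1,\dots,n\bigr]$$ goes from the polynomial ring in the path-probability variables to the polynomial ring in independent indeterminates $\pi_{i_1\ldots i_k}$ (one for each element of $S^k$) and $a^{(\ell)}_{i_{\ell-k}\cdots i_\ell}$ (one for each $\ell\in\{k+1,\dots,n\}$ and each element of $S^{k+1}$), and is defined by $$\phi^*(p_{i_1\ldots i_n})=\pi_{i_1\ldots i_k}\prod_{\ell=k+1}^n a^{(\ell)}_{i_{\ell-k}\cdots i_{\ell-1}i_\ell}.$$ *)

(* Defs.v *)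
From mathcomp Require Import all_boot all_order all_algebra.
From mathcomp Require Import reals.
From mathcomp Require Import mpoly.

Set Implicit Arguments.
Unset Strict Implicit.
Unset Printing Implicit Defensive.

Import GRing.Theory.
Local Open Scope ring_scope.

(* Polynomial ring R[x_t | t in T] in indeterminates indexed by a finite type
   T, through the enumeration T = {t_0, ..., t_(#|T|-1)}. *)
Notation polyring R T := {mpoly R[#|{: T}|]}.

Definition indet (R : realType) (T : finType) (t : T) : polyring R T :=
  'X_(enum_rank t).

Definition ideal_gen (A : comNzRingType) (G : A -> Prop) (f : A) : Prop :=
  exists s : seq (A * A),
    (forall cg, cg \in s -> G cg.2) /\ f = \sum_(cg <- s) cg.1 * cg.2.

(* Positions in tuples are numbered from 0.
   [inl I] with I in S^k is the index of pi_I; [inr (j, w)] is the index of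
   a^(l)_w with l = k + 1 + j, so that j < n - k means k + 1 <= l <= n. *)
Definition param (S : finType) (k n : nat) : finType :=
  (k.-tuple S + 'I_(n - k) * k.+1.-tuple S)%type.

Definition initial (S : finType) (k n : nat) (hkn : (k < n)%N) (w : n.-tuple S) :
    k.-tuple S :=
  [tuple tnth w (widen_ord (ltnW hkn) t) | t < k].

Lemma window_lt (k n : nat) (j : 'I_(n - k)) (t : 'I_k.+1) : (j + t < n)%N.
Proof.
have := ltn_ord j; rewrite ltn_subRL addnC => h.
by apply: leq_ltn_trans h; rewrite leq_add2l -ltnS.
Qed.

(* (i_(l-k), ..., i_l) for l = k + 1 + j *)
Definition window (S : finType) (k n : nat) (w : n.-tuple S) (j : 'I_(n - k)) :
    k.+1.-tuple S :=
  [tuple tnth w (Ordinal (window_lt j t)) | t < k.+1].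

Definition phi_indet (R : realType) (S : finType) (k n : nat) (hkn : (k < n)%N)
    (w : n.-tuple S) : polyring R (param S k n) :=
  indet R (inl (initial hkn w) : param S k n) *
  \prod_(j < n - k) indet R (inr (j, window w j) : param S k n).

Definition phi (R : realType) (S : finType) (k n : nat) (hkn : (k < n)%N) :
    {rmorphism polyring R (n.-tuple S) -> polyring R (param S k n)} :=
  comp_mpoly [tuple phi_indet R hkn (enum_val i) | i < #|{: n.-tuple S}|].

Lemma phi_indetE (R : realType) (S : finType) (k n : nat) (hkn : (k < n)%N)
    (w : n.-tuple S) : phi R S hkn (indet R w) = phi_indet R hkn w.
Proof.
by rewrite /phi /indet /= comp_mpolyXU -tnth_nth tnth_mktuple enum_rankK.
Qed.

Lemma phiC (R : realType) (S : finType) (k n : nat) (hkn : (k < n)%N) (c : R) :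
  phi R S hkn c%:MP = c%:MP.
Proof. exact: comp_mpolyC. Qed.

Lemma size_path_cat (k n : nat) (hkn : (k < n)%N) (r : 'I_(n - k).+1) :
  (r + (k + (n - k - r)) = n)%N.
Proof. by rewrite addnCA !subnKC ?(ltnW hkn) // -ltnS. Qed.

Definition path_cat (S : finType) (k n : nat) (hkn : (k < n)%N)
    (r : 'I_(n - k).+1) (I : r.-tuple S) (J : k.-tuple S)
    (K : (n - k - r).-tuple S) : n.-tuple S :=
  tcast (size_path_cat hkn r) [tuple of I ++ J ++ K].

Lemma val_path_cat (S : finType) (k n : nat) (hkn : (k < n)%N)
    (r : 'I_(n - k).+1) (I : r.-tuple S) (J : k.-tuple S)
    (K : (n - k - r).-tuple S) :
  tval (path_cat hkn I J K) = I ++ J ++ K.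
Proof. by rewrite val_tcast. Qed.

Definition markov_binomial (R : realType) (S : finType) (k n : nat)
    (hkn : (k < n)%N) (f : polyring R (n.-tuple S)) : Prop :=
  exists (r : 'I_(n - k).+1) (I I' : r.-tuple S) (J : k.-tuple S)
         (K K' : (n - k - r).-tuple S),
    let p := fun A B C => indet R (path_cat hkn A B C) in
    f = p I J K * p I' J K' - p I J K' * p I' J K.

(* Main.v *)
Require Import Defs.
From mathcomp Require Import all_boot all_order all_algebra.
From mathcomp Require Import reals.
From mathcomp Require Import mpoly.
From mathcomp Require Import zify.

Set Implicit Arguments.
Unset Strict Implicit.
Unset Printing Implicit Defensive.

Import GRing.Theory.
Local Open Scope ring_scope.

(** Since [phi] maps monomials to monomials, its kernel is spanned by the
    differences of two monomials with the same image, i.e. of two multisets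
    [s], [s'] of paths in which every parameter occurs equally often.  Such an
    [s] can be transformed into [s'] by exchanging tails: fix a path [w'] of
    [s'].  Some path [w] of [s] has the same initial segment as [w'], and if
    [w] agrees with [w'] up to time [r + k], then some [v] in [s] has the same
    [r]-th window as [w']; exchanging the tails of [w] and [v] after time
    [r + k] makes [w] agree with [w'] one step further.  Once [w = w'], cancel
    it and iterate. *)

(** * Closure properties of generated ideals *)

Section IdealGen.
Variables (A : comNzRingType) (G : A -> Prop).

Lemma ideal_gen_base g : G g -> ideal_gen G g.
Proof.
move=> Gg; exists [:: (1, g)]; split; last by rewrite big_seq1 mul1r.
by move=> cg; rewrite inE => /eqP ->.
Qed.

Lemma ideal_gen0 : ideal_gen G 0.
Proof. by exists [::]; split=> //; rewrite big_nil. Qed.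

Lemma ideal_genD a b : ideal_gen G a -> ideal_gen G b -> ideal_gen G (a + b).
Proof.
move=> [s [Gs ->]] [t [Gt ->]]; exists (s ++ t); split; last by rewrite big_cat.
by move=> cg; rewrite mem_cat => /orP[/Gs|/Gt].
Qed.

Lemma ideal_genM c a : ideal_gen G a -> ideal_gen G (c * a).
Proof.
move=> [s [Gs ->]]; exists [seq (c * cg.1, cg.2) | cg <- s]; split.
  by move=> _ /mapP[cg /Gs Gcg ->].
by rewrite big_map mulr_sumr; apply: eq_bigr => cg _; rewrite mulrA.
Qed.

Lemma ideal_gen_sum (T : eqType) (s : seq T) (F : T -> A) :
  (forall x, x \in s -> ideal_gen G (F x)) -> ideal_gen G (\sum_(x <- s) F x).
Proof.
move=> GF; rewrite big_seq; elim/big_ind: _ => //.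
- exact: ideal_gen0.
- exact: ideal_genD.
Qed.

Lemma ideal_gen_trans b a c :
  ideal_gen G (a - b) -> ideal_gen G (b - c) -> ideal_gen G (a - c).
Proof. by move=> ab bc; rewrite -(subrKA b); apply: ideal_genD. Qed.

End IdealGen.

(** * Segments of paths as subwords *)

Section Paths.
Variables (S : finType) (k n : nat) (hkn : (k < n)%N).
Implicit Types (w v : n.-tuple S) (s t : seq (n.-tuple S)) (q : param S k n).

Lemma val_initial w : initial hkn w = take k w :> seq S.
Proof.
have kn := ltnW hkn; have x0 : S by case: w => -[|x u] //= /eqP E; lia.
apply: (@eq_from_nth _ x0); first by rewrite size_tuple size_takel ?size_tuple.
move=> i; rewrite size_tuple => ik.
by rewrite -[i]/(val (Ordinal ik)) -tnth_nth tnth_mktuple (tnth_nth x0) nth_take.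
Qed.

Lemma val_window w (j : 'I_(n - k)) : window w j = take k.+1 (drop j w) :> seq S.
Proof.
have := ltn_ord j => jnk.
have x0 : S by case: w => -[|x u] //= /eqP E; lia.
have sz : (k.+1 <= size (drop j w))%N by rewrite size_drop size_tuple; lia.
apply: (@eq_from_nth _ x0); first by rewrite size_tuple size_takel.
move=> i; rewrite size_tuple => ik.
rewrite -[i]/(val (Ordinal ik)) -tnth_nth tnth_mktuple (tnth_nth x0) /=.
by rewrite nth_take // nth_drop.
Qed.

Lemma path_catP (r : 'I_(n - k).+1) w :
  exists (I : r.-tuple S) (J : k.-tuple S) (K : (n - k - r).-tuple S),
    [/\ w = path_cat hkn I J K, I = take r w :> seq S
      & J = take k (drop r w) :> seq S].
Proof.
have := ltn_ord r => rnk.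
have sI : size (take r w) == r by rewrite size_takel ?size_tuple //; lia.
have sJ : size (take k (drop r w)) == k.
  by rewrite size_takel // size_drop size_tuple; lia.
have sK : size (drop k (drop r w)) == (n - k - r)%N.
  by rewrite !size_drop size_tuple; apply/eqP; lia.
exists (Tuple sI), (Tuple sJ), (Tuple sK); split=> //.
by apply: val_inj; rewrite /= val_path_cat /= !cat_take_drop.
Qed.

(** The exponent, 0 or 1, of the indeterminate [q] in [phi_indet R hkn w]. *)
Definition occurs q w : bool :=
  match q with
  | inl u => initial hkn w == u
  | inr jv => window w jv.1 == jv.2
  end.

(** * Exchanging tails behind a common segment [J] *)

Section Exchange.
Variables (r : 'I_(n - k).+1) (J : k.-tuple S).
Implicit Types (I : r.-tuple S) (K : (n - k - r).-tuple S).

Lemma initial_path_cat I K K' :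
  initial hkn (path_cat hkn I J K) = initial hkn (path_cat hkn I J K').
Proof.
apply: val_inj; rewrite /= !val_initial !val_path_cat !catA.
by rewrite !(@takel_cat k _ (_ ++ J)) // size_cat !size_tuple leq_addl.
Qed.

(** The window ends at position [j + k < r + k], hence inside [I ++ J]. *)
Lemma window_path_cat_head (j : 'I_(n - k)) I K K' : (j < r)%N ->
  window (path_cat hkn I J K) j = window (path_cat hkn I J K') j.
Proof.
move=> jr; apply: val_inj; rewrite /= !val_window !val_path_cat !catA.
have sIJ : size (I ++ J) = (r + k)%N by rewrite size_cat !size_tuple.
rewrite !(drop_cat j (I ++ J)) sIJ ltn_addr //.
by rewrite !takel_cat // size_drop sIJ; lia.
Qed.

Lemma window_path_cat_tail (j : 'I_(n - k)) I I' K : (r <= j)%N ->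
  window (path_cat hkn I J K) j = window (path_cat hkn I' J K) j.
Proof.
move=> rj; apply: val_inj; rewrite /= !val_window !val_path_cat.
by rewrite !drop_cat !size_tuple ltnNge rj.
Qed.

(** Every parameter reads letters of [I ++ J] only or of [J ++ K] only. Its occurrence thus ignores
    the tail or ignores the head, and both sides have the same two terms. *)
Lemma occurs_exchange q I I' K K' :
  (occurs q (path_cat hkn I J K) + occurs q (path_cat hkn I' J K') =
   occurs q (path_cat hkn I J K') + occurs q (path_cat hkn I' J K))%N.
Proof.
case: q => [I0 | [j v]] /=.
  by rewrite (initial_path_cat I K K') (initial_path_cat I' K K').
have [jr|rj] := ltnP j r.
  by rewrite (window_path_cat_head I K K' jr) (window_path_cat_head I' K K' jr).
rewrite addnC (window_path_cat_tail I I' K rj).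
by rewrite (window_path_cat_tail I I' K' rj).
Qed.

End Exchange.

(** * Images of monomials under [phi] *)

Variable R : realType.
Local Notation P := (polyring R (n.-tuple S)).
Local Notation ideal := (@ideal_gen P (@markov_binomial R S k n hkn)).

Definition path_prod s : P := \prod_(w <- s) indet R w.

Definition param_mon w : 'X_{1.. #|{: param S k n}|} :=
  [multinom nat_of_bool (occurs (enum_val i) w) | i < #|{: param S k n}|].

Lemma phi_indet_mon w : phi_indet R hkn w = 'X_[param_mon w].
Proof.
rewrite /phi_indet /indet mprodXE -mpolyXD; congr ('X_[_]).
apply/mnmP => i; rewrite mnmDE mnm_sumE [RHS]mnmE mnm1E.
under eq_bigr do rewrite mnm1E.
have eqe q : (enum_rank q == i) = (q == enum_val i).
  by rewrite -(inj_eq enum_val_inj) enum_rankK.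
under eq_bigr do rewrite eqe.
rewrite eqe; case: (enum_val i) => [u | [j v]] /=.
  by rewrite big1 ?addn0.
(* Only the factor with index [j] can be the indeterminate [(j, v)], so the exponent is at most
   1. *)
rewrite (bigD1 j) //= big1 ?addn0 => [|l lj].
  by congr nat_of_bool; apply/eqP/eqP => [[]|->].
by case: eqP => // -[] E; rewrite E eqxx in lj.
Qed.

Lemma phi_path_prod s :
  phi R S hkn (path_prod s) = 'X_[(\sum_(w <- s) param_mon w)%MM].
Proof.
rewrite /path_prod rmorph_prod -mprodXE.
by apply: eq_bigr => w _; rewrite phi_indetE phi_indet_mon.
Qed.

(** Turns equality of images under [phi] into the equality of counts that tail exchanges
    preserve. *)
Lemma count_param_mon s q :
  count (occurs q) s = (\sum_(w <- s) param_mon w)%MM (enum_rank q).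
Proof.
rewrite mnm_sumE -sum1_count big_mkcond; apply: eq_bigr => w _.
by rewrite mnmE enum_rankK; case: occurs.
Qed.

Lemma phi_markov_binomial (g : P) : markov_binomial hkn g -> phi R S hkn g = 0.
Proof.
move=> [r [I [I' [J [K [K' ->]]]]]].
rewrite rmorphB !rmorphM !phi_indetE !phi_indet_mon -!mpolyXD.
apply/eqP; rewrite subr_eq0; apply/eqP; congr ('X_[_]).
by apply/mnmP => i; rewrite !mnmDE !mnmE occurs_exchange.
Qed.

(** * Rewriting monomials by tail exchanges *)

Lemma path_prod_perm s t : perm_eq s t -> path_prod s = path_prod t.
Proof. exact: perm_big. Qed.

Lemma exchange_step (r : 'I_(n - k)) w' w s :
  take (r + k) w = take (r + k) w' ->
  has (occurs (inr (r, window w' r))) (w :: s) ->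
  exists v t, [/\ take (r.+1 + k) v = take (r.+1 + k) w',
    forall q, count (occurs q) (v :: t) = count (occurs q) (w :: s)
    & ideal (path_prod (w :: s) - path_prod (v :: t))].
Proof.
have r_lt := ltn_ord r.
move=> ww' /hasP /= [v]; rewrite inE => vs /eqP /(congr1 val) /=.
rewrite !val_window => vw'.
(* A prefix of length [r.+1 + k = r + k.+1] is [r] letters followed by the [r]-th window. *)
have extend x : take r x = take r w' ->
    take k.+1 (drop r x) = take k.+1 (drop r w') ->
    take (r.+1 + k) x = take (r.+1 + k) w'.
  by move=> e1 e2; rewrite addSnnS !takeD e1 e2.
have wr : take r w = take r w'.
  by rewrite -(take_takel w (leq_addr k r)) ww' take_takel ?leq_addr.
have wk : take k (drop r w) = take k (drop r w').
  by rewrite !take_drop addnC ww'.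
case/orP: vs => [/eqP vw | vs].
  exists w, s; split=> //; first by apply: extend => //; rewrite -vw.
  by rewrite subrr; apply: ideal_gen0.
pose r' : 'I_(n - k).+1 := widen_ord (leqnSn _) r.
have [I [J [K [Ew EI EJ]]]] := path_catP r' w.
have [I' [J' [K' [Ev EI' EJ']]]] := path_catP r' v.
(* Both middle segments are the first [k] letters of the [r]-th window of [w']: for [w] by agreement
   up to [r + k], for [v] by the choice of [v]. *)
have EJJ : J' = J.
  apply: val_inj; rewrite /= EJ EJ' /= wk.
  by rewrite -(take_takel _ (leqnSn k)) vw' take_takel.
subst J'; have ps := perm_to_rem vs.
(* The new path takes its first [r] letters from [w] and the rest, including the wanted window, from
   [v]. *)
exists (path_cat hkn I J K'), (path_cat hkn I' J K :: rem v s); split.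
- apply: extend.
    by rewrite val_path_cat takel_cat ?size_tuple // take_oversize ?size_tuple // EI.
  rewrite -vw' Ev !val_path_cat.
  by rewrite !drop_cat !size_tuple ltnn subnn !drop0.
- move=> q; rewrite /= (permP ps) /= !addnA; congr addn.
  by rewrite [in RHS]Ew [in RHS]Ev occurs_exchange.
- have -> : path_prod (w :: s) = path_prod (w :: v :: rem v s).
    by apply: path_prod_perm; rewrite perm_cons.
  rewrite /path_prod !big_cons !mulrA -mulrBl mulrC.
  apply/ideal_genM/ideal_gen_base; exists r', I, I', J, K, K'.
  by rewrite /= -Ew -Ev.
Qed.

Lemma exchange_to s w' s' :
  (forall q, count (occurs q) s = count (occurs q) (w' :: s')) ->
  exists t, (forall q, count (occurs q) (w' :: t) = count (occurs q) s) /\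
    ideal (path_prod s - path_prod (w' :: t)).
Proof.
move=> eqs.
have has_s s1 q : (forall q, count (occurs q) s1 = count (occurs q) s) ->
    occurs q w' -> has (occurs q) s1.
  by move=> eq1 qw'; rewrite has_count eq1 eqs /= qw'.
suff main r : (r <= n - k)%N -> exists w t,
    [/\ take (r + k) w = take (r + k) w',
      forall q, count (occurs q) (w :: t) = count (occurs q) s
      & ideal (path_prod s - path_prod (w :: t))].
  (* At [r = n - k] the common prefix has length [n], so it is the whole path. *)
  have [w [t [ww' cnt idl]]] := main _ (leqnn _).
  move: ww'; rewrite subnK ?(ltnW hkn) // !take_oversize ?size_tuple //.
  by move=> /val_inj ww'; exists t; rewrite -ww'.
elim: r => [_|r IHr rnk].
  have /hasP[w ws /eqP /(congr1 val) /=] :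
    has (occurs (inl (initial hkn w'))) s by apply: has_s => //=.
  rewrite !val_initial => ww'.
  exists w, (rem w s); split=> //.
    by move=> q; rewrite [RHS](permP (perm_to_rem ws)).
  by rewrite (path_prod_perm (perm_to_rem ws)) subrr; apply: ideal_gen0.
have [w [t [ww' cnt idl]]] := IHr (ltnW rnk).
have [|v [t' [vw' cnt' idl']]] := @exchange_step (Ordinal rnk) w' w t ww'.
  by apply: has_s => //=.
exists v, t'; split=> //; first by move=> q; rewrite cnt'.
exact: ideal_gen_trans idl idl'.
Qed.

(** Induction on [s']: once [w'] heads both lists, it factors out of the difference and out of the
    counts. *)
Lemma ideal_path_prod s s' :
  (forall q, count (occurs q) s = count (occurs q) s') ->
  ideal (path_prod s - path_prod s').
Proof.
elim: s' s => [|w' s' IHs] s eqs.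
  case: s eqs => [|w s] eqs; first by rewrite subrr; apply: ideal_gen0.
  (* A nonempty [s] has a nonzero count at the initial segment of its first path. *)
  by have := eqs (inl (initial hkn w)); rewrite /= eqxx.
have [t [cnt idl]] := exchange_to eqs.
apply: ideal_gen_trans idl _; rewrite /path_prod !big_cons -mulrBr.
apply/ideal_genM/IHs => q; apply: (@addnI (occurs q w')).
by rewrite -[LHS]/(count (occurs q) (w' :: t)) cnt eqs.
Qed.

(** * Elements of the kernel *)

Lemma monomial_path_prod (m : 'X_{1.. #|{: n.-tuple S}|}) :
  {s | 'X_[m] = path_prod s}.
Proof.
exists (flatten [seq nseq (m i) (enum_val i) | i <- enum 'I_#|{: n.-tuple S}|]).
rewrite mpolyXE_id /path_prod big_flatten big_map big_enum /=.
apply: eq_bigr => i _; rewrite big_nseq /indet enum_valK.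
by elim: (m i) => //= l IHl; rewrite exprS IHl.
Qed.

Lemma ker_phi_ideal (f : P) : phi R S hkn f = 0 -> ideal f.
Proof.
move=> phif0; pose s m := sval (monomial_path_prod m).
have sE m : 'X_[m] = path_prod (s m) by rewrite /s; case: monomial_path_prod.
pose st m := (\sum_(w <- s m) param_mon w)%MM.
have phiX m : phi R S hkn 'X_[m] = 'X_[st m] by rewrite sE phi_path_prod.
have idX m m' : st m = st m' -> ideal ('X_[m] - 'X_[m']).
  move=> E; rewrite !sE; apply: ideal_path_prod => q.
  by rewrite !count_param_mon -/(st m) E.
have phiE : phi R S hkn f = \sum_(m <- msupp f) f@_m *: 'X_[st m].
  rewrite {1}[f]mpolyE rmorph_sum; apply: eq_bigr => m _.
  by rewrite -!mul_mpolyC rmorphM phiC phiX.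
pose sts := [seq st m | m <- msupp f].
(* [g] chooses one support monomial in each fibre of [st]; the default is not reached for [M] in
   [sts]. *)
pose g M := nth 0%MM (msupp f) (index M sts).
have stg m : m \in msupp f -> st (g (st m)) = st m.
  move=> mf; have ms : st m \in sts by apply: map_f.
  by rewrite -(nth_map _ (st 0%MM)) ?nth_index // -(size_map st) index_mem.
have sum0 : \sum_(m <- msupp f) f@_m *: 'X_[g (st m)] = 0 :> P.
  (* Grouping by fibres, the coefficients of the monomials over [M] add up to the coefficient of
     ['X_[M]] in the image of [f]. *)
  transitivity (\sum_(M <- undup sts) (phi R S hkn f)@_M *: 'X_[g M] : P).
    under [RHS]eq_bigr do rewrite phiE raddf_sum scaler_suml.
    rewrite exchange_big /= big_seq [RHS]big_seq; apply: eq_bigr => m mf.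
    rewrite (bigD1_seq (st m)) ?undup_uniq ?mem_undup ?map_f //=.
    rewrite mcoeffZ mcoeffX eqxx mulr1 big1 ?addr0 // => M Mm.
    by rewrite mcoeffZ mcoeffX eq_sym (negbTE Mm) mulr0 scale0r.
  by rewrite phif0 big1 // => M _; rewrite mcoeff0 scale0r.
(* Subtracting this zero sum writes [f] as a combination of differences of monomials with equal
   image. *)
rewrite [f]mpolyE -[X in ideal X]subr0 -[X in _ - X]sum0 -sumrB.
apply: ideal_gen_sum => m mf; rewrite -scalerBr -mul_mpolyC.
by apply/ideal_genM/idX; rewrite stg.
Qed.

End Paths.

Theorem proposition4p5 (R : realType) (S : finType) (k n : nat)
    (hS : (0 < #|S|)%N) (hk : (1 <= k)%N) (hkn : (k < n)%N)
    (f : polyring R (n.-tuple S)) :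
  phi R S hkn f = 0 <-> ideal_gen (@markov_binomial R S k n hkn) f.
Proof.
split=> [|[s [Gs ->]]]; first exact: ker_phi_ideal.
rewrite rmorph_sum big_seq big1 => [//|cg cgs].
by rewrite rmorphM (phi_markov_binomial (Gs _ cgs)) mulr0.
Qed.
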